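(* Let $G$ be a finite group whose power graph $\mathrm{Pow}(G)$ is chordal. If $\wp$ is an induced path on $L$ vertices in $\mathrm{Pow}(G)$, then $L\leq 19$. In particular, if $G$ is any finite group, then $\mathrm{Pow}(G)$ is chordal if and only if it contains neither an induced cycle of length $\ell$ with $4\le \ell\leq 20$ nor an induced path of length $20$.
   Context: The power graph $\mathrm{Pow}(G)$ of a group $G$ is the simple graph with vertex set $G$ in which two distinct elements $x,y$ are joined by an edge if and only if $x^m=y$ or $y^m=x$ for some $m\in\mathbb{N}$. A graph is chordal if it has no induced cycle on at least four vertices. The length of a path or of a cycle is the number of its vertices. *)

(* Defs.v *)
From mathcomp Require Import all_boot all_fingroup.

Set Implicit Arguments.
Unset Strict Implicit.
Unset Printing Implicit Defensive.

Local Open Scope group_scope.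

Record simple_graph (T : finType) := SimpleGraph {
  vertices : {set T};
  adj : T -> T -> Prop;
  adj_vertices : forall x y, adj x y -> x \in vertices /\ y \in vertices;
  adj_irrefl : forall x, ~ adj x x;
  adj_sym : forall x y, adj x y -> adj y x
}.

Section InducedSubgraphs.

Variables (T : finType) (Gamma : simple_graph T).

Definition induced_path (L : nat) (p : 'I_L -> T) : Prop :=
  [/\ injective p,
      forall i, p i \in vertices Gamma
    & forall i j : 'I_L,
        adj Gamma (p i) (p j) <-> (j = i.+1 :> nat \/ i = j.+1 :> nat)].

Definition induced_cycle (l : nat) (c : 'I_l -> T) : Prop :=
  [/\ 3 <= l,
      injective c,
      forall i, c i \in vertices Gamma
    & forall i j : 'I_l,
        adj Gamma (c i) (c j) <->
          (j = i.+1 %% l :> nat \/ i = j.+1 %% l :> nat)].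

Definition has_induced_path (L : nat) : Prop :=
  exists p : 'I_L -> T, induced_path p.

Definition has_induced_cycle (l : nat) : Prop :=
  exists c : 'I_l -> T, induced_cycle c.

Definition chordal : Prop := forall l, 4 <= l -> ~ has_induced_cycle l.

End InducedSubgraphs.

Section PowerGraph.

Variables (gT : finGroupType) (G : {group gT}).

Definition power_adj (x y : gT) : Prop :=
  [/\ x \in G, y \in G, x <> y
    & exists m : nat, x ^+ m = y \/ y ^+ m = x].

Lemma power_adj_vertices x y : power_adj x y -> x \in G /\ y \in G.
Proof. by case. Qed.

Lemma power_adj_irrefl x : ~ power_adj x x.
Proof. by case. Qed.

Lemma power_adj_sym x y : power_adj x y -> power_adj y x.
Proof.
case=> Gx Gy neq_xy [m xy]; split=> //; first by move/esym.
by exists m; case: xy; [right | left].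
Qed.

Definition Pow : simple_graph gT :=
  SimpleGraph power_adj_vertices power_adj_irrefl power_adj_sym.

End PowerGraph.

(* Main.v *)
Require Import Defs.
From mathcomp Require Import all_boot all_fingroup.
From mathcomp Require Import cyclic pgroup commutator zify.

(** Let T be the graph whose vertices are the subgroups of prime order of G, two
    of them being joined when they commute and have different orders (the
    relation [prime_edge]). Everything is read off T.

    If Pow(G) is chordal, then T is a forest: a cycle A_1, ..., A_n of T, with
    A_k generated by a_k, gives the induced cycle a_1, a_1 a_2, a_2, a_2 a_3,
    ..., a_n a_1 of length 2n in Pow(G) ([chordal_prime_edge_acyclic]).

    In such a forest every path has at most 9 vertices ([prime_path_bound]). By
    conjugation G acts on T. The edges cannot be inverted, since their ends have
    different orders, so in each component some vertex R is fixed by all the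
    elements of G that stabilise this component ([forest_fixed_vertex]). Consider
    a path R = Z_0, Z_1, ..., Z_m. Since Z_(i+1) centralises Z_i, it fixes both
    ends, hence all the vertices, of the path from R to Z_i: each Z_i normalises
    all its predecessors. Automorphism groups of groups of prime order being
    abelian, these relations determine most of the orders of the Z_i, and m = 5
    contradicts acyclicity ([prime_depth]). So all the vertices of the component
    are at distance at most 4 from R, and its paths have at most 8 edges.

    Finally, an induced path of Pow(G) alternates between small cyclic groups
    Y_i and large cyclic groups H_i containing Y_i and Y_(i+1), since the
    inclusion of cyclic groups is transitive. Among 20 vertices there are ten Y_i.
    As Pow(G) has no induced 4-cycle, each Y_i with two neighbours has prime power
    order; choosing in each Y_i a suitable subgroup of prime order yields a walk
    of ten vertices of T that never turns back, i.e., a path of T, which is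
    impossible ([chordal_no_zigzag]). An induced cycle on more than 20 vertices
    contains an induced path on 20 vertices, whence the second assertion. *)

(** * Paths in finite forests *)

Section Forest.

Variables (T : finType) (e : rel T).
Hypothesis e_irr : irreflexive e.
Hypothesis e_sym : symmetric e.
Hypothesis acyclic : forall s, path.cycle e s -> uniq s -> size s <= 2.

Lemma forest_chord x p :
  path e x p -> uniq (x :: p) -> e x (last x p) -> size p <= 1.
Proof.
move=> xp Up xy; apply: (acyclic (x :: p)) => //=.
by rewrite rcons_path xp e_sym.
Qed.

(** Two paths that separate at x and meet again close up into a cycle: it
    follows p until its first vertex c on q, and returns to x along q. *)
Lemma forest_path_unique x p q :
    path e x p -> path e x q -> uniq (x :: p) -> uniq (x :: q) ->
  last x p = last x q -> p = q.
Proof.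
elim: p x q => [|a p IHp] x q.
  case: q => //= b q _ _ _ /andP[xq _] def_x; case/negP: xq.
  by rewrite def_x mem_last.
case: q => [|b q].
  move=> _ _ /andP[xp _] _ /= def_x; case/negP: xp.
  by rewrite -def_x mem_last.
move=> xp xq Up Uq eq_last; have [eq_ab|/eqP[]] := eqVneq a b.
  rewrite -{b}eq_ab in xq Uq eq_last *; congr (_ :: _).
  apply: (IHp a) => //; [by case/andP: xp | by case/andP: xq | |].
    by case/andP: Up.
  by case/andP: Uq.
have: has [in b :: q] (a :: p).
  apply/hasP; exists (last a p); first exact: mem_last.
  by rewrite /= (eq_last : last a p = last b q) mem_last.
have [-> ->]: a = head x (a :: p) /\ b = head x (b :: q) by [].
move: (a :: p) (b :: q) xp xq Up Uq {IHp eq_last} => {a b}p {}q xp xq Up Uq.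
move=> has_c; case: (split_find has_c) xp Up => c p1 p2 qc p1q'.
rewrite cat_rcons /= cat_path cat_uniq /= => /and3P[xp1 p1c _].
rewrite mem_cat negb_or => /andP[/andP[xp1' xp2'] /and3P[Up1 p1p2' _]].
case/splitPr: qc xq Uq p1q' => q1 q2.
rewrite cat_path /= cat_uniq mem_cat !inE /=.
rewrite !negb_or => /and3P[xq1 q1c _] /andP[/and3P[xq1' neq_xc _]].
case/and3P=> Uq1 /andP[cq1 _] _ p1q'.
(* If the cycle through p1, c and q1 has two vertices, then p1 and q1 are empty
   and both paths start with c. *)
suff: size (x :: p1 ++ c :: rev q1) <= 2.
  rewrite /= size_cat /= size_rev addnS !ltnS.
  by case: p1 {xp1 p1c xp1' Up1 p1p2' p1q'} => //; case: q1 {xq1 q1c xq1' Uq1 cq1}.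
apply: acyclic.
  rewrite /= -cats1 -catA cat_path xp1 /= p1c /=.
  have := rev_path e x (rcons q1 c).
  rewrite last_rcons belast_rcons rev_cons -cats1 => ->.
  by rewrite (eq_path (e' := e)) ?rcons_path ?xq1.
rewrite cons_uniq mem_cat inE mem_rev !negb_or xp1' neq_xc xq1' /=.
rewrite cat_uniq Up1 /= mem_rev cq1 rev_uniq Uq1 !andbT.
rewrite negb_or; move: p1p2'; rewrite negb_or => /andP[-> _] /=.
apply/hasPn=> z; rewrite mem_rev => q1z; apply: contra p1q' => p1z.
by apply/hasP; exists z => //=; rewrite mem_cat q1z.
Qed.

(** A walk in a forest can come back to a vertex only by retracing an edge,
    since its first return would otherwise close a cycle. *)
Lemma forest_walk_uniq x0 s :
    sorted e s -> (forall i, i.+2 < size s -> nth x0 s i != nth x0 s i.+2) ->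
  uniq s.
Proof.
elim: s => //= x s IHs xs nbt.
have Us: uniq s.
  by apply: IHs => [|i lt_i]; [apply: path_sorted xs | apply: (nbt i.+1)].
rewrite Us andbT; apply/negP=> sx; case/splitPr: sx xs Us nbt => s1 s2.
rewrite cat_path cat_uniq /= negb_or => /and3P[xs1 s1x _].
case/and3P=> Us1 /andP[s1x' _] _ nbt.
have: size (x :: s1) <= 2.
  by apply: acyclic; rewrite /= ?rcons_path ?xs1 // s1x'.
case: s1 xs1 s1x {Us1 s1x'} nbt => [|a [|b s1]] //=.
  by rewrite e_irr.
by move=> _ _ /(_ 0 isT)/eqP[].
Qed.

Definition path_connected (K : {set T}) :=
  {in K &, forall x y, exists p,
     [/\ path e x p, uniq (x :: p), last x p = y & {subset p <= K}]}.

(** In a tree with vertex set K, these are the vertices other than the leaves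
    and the isolated vertex. *)
Definition inner (K : {set T}) :=
  [set x in K | 1 < #|[set y in K | e x y]|].

(** A vertex in the middle of a path has its two neighbours on the path, so
    only the ends of a path can be leaves. *)
Lemma inner_of_path (K : {set T}) x p z :
    x \in K -> {subset p <= K} -> path e x p -> uniq (x :: p) ->
  z \in p -> z != last x p -> z \in inner K.
Proof.
move=> Kx + + + pz; case/splitPr: pz => p1 [|b p2] sKp.
  by rewrite last_cat eqxx.
rewrite cat_path -cat_cons cat_uniq => /and4P[_ az zb _] /and3P[_ Upz _] _.
have Ka: last x p1 \in K.
  have := mem_last x p1; rewrite inE => /predU1P[-> // | p1a].
  by apply: sKp; rewrite mem_cat p1a.
have Kz: z \in K by apply: sKp; rewrite mem_cat mem_head orbT.
have Kb: b \in K by apply: sKp; rewrite mem_cat !inE eqxx !orbT.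
rewrite inE Kz (leq_trans _ (subset_leq_card (_ : [set last x p1; b] \subset _))).
- by [].
- rewrite cards2; case: eqP => // eq_ab; case/hasP: Upz.
  exists b; first by rewrite !inE eqxx orbT.
  by rewrite -eq_ab; apply: mem_last.
by apply/subsetP=> y /set2P[]->; rewrite inE ?Ka ?Kb // e_sym.
Qed.

Lemma inner_connected (K : {set T}) :
  path_connected K -> path_connected (inner K).
Proof.
move=> connK x y K'x K'y.
have [/setIdP[Kx _] /setIdP[Ky _]] := (K'x, K'y).
have [p [xp Up eq_y sKp]] := connK x y Kx Ky.
exists p; split=> // z pz; have [->|neq_zy] := eqVneq z y; first by [].
by apply: (inner_of_path _ x p); rewrite ?eq_y.
Qed.

(** If every vertex of K had two neighbours in K, then any path could be
    extended at its head by a neighbour other than the next vertex; this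
    neighbour would be new, by acyclicity, and paths would be arbitrarily long. *)
Lemma inner_proper (K : {set T}) x0 : x0 \in K -> inner K \proper K.
Proof.
move=> Kx0; have sK'K: inner K \subset K by apply/subsetP=> x /setIdP[].
rewrite properE sK'K; apply/negP=> /subsetP sKK'.
have long n: exists x p,
    [/\ path e x p, uniq (x :: p), size p = n & {subset x :: p <= K}].
  elim: n => [|n [x [p [xp Up sz_p sKp]]]].
    by exists x0, [::]; split=> // x /[!inE] /eqP->.
  have Kx: x \in K by apply: sKp; apply: mem_head.
  have /setIdP[_ nbr2] := sKK' x Kx.
  have [y /setIdP[Ky xy] neq_y]: exists2 y,
    y \in [set y in K | e x y] & y != head x p.
  + move: nbr2; rewrite (cardsD1 (head x p)) => nbr2.
    have: 0 < #|[set y in K | e x y] :\ head x p|.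
      by case: (_ \in _) nbr2 => /=; lia.
    by case/card_gt0P=> y /setD1P[]; exists y.
  exists y, (x :: p); split=> /=; last 2 first.
  - by rewrite sz_p.
  - by move=> z /predU1P[->|/sKp].
  - by rewrite e_sym xy.
  rewrite -/(uniq (x :: p)) Up andbT inE negb_or; apply/andP; split.
    by apply: contraTneq xy => ->; rewrite e_irr.
  apply: contra neq_y => py; case/splitPr: py xp Up {sz_p sKp} => p1 p2.
  rewrite cat_path -cat_rcons -cat_cons cat_uniq /= => /and3P[xp1 p1y _].
  case/andP=> Up1 _.
  have:= forest_chord x (rcons p1 y).
  rewrite rcons_path last_rcons xp1 p1y size_rcons => /(_ isT Up1 xy).
  by case: (p1) => //=.
have [x [p [_ Up sz_p _]]] := long #|T|.
by have := max_card (mem (x :: p)); rewrite (card_uniqP Up) /= sz_p ltnn.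
Qed.

(** Stripping the leaves of a tree is compatible with all its automorphisms. It
    eventually leaves one vertex, which is then fixed by every automorphism,
    or a single edge, whose ends cannot be exchanged since they have different
    colours. *)
Lemma forest_fixed_vertex (col : T -> nat) (K : {set T}) x0 :
    (forall x y, e x y -> col x <> col y) ->
    x0 \in K -> path_connected K ->
  exists2 r, r \in K & forall f : T -> T,
    injective f -> {mono f : x y / e x y} -> (forall x, col (f x) = col x) ->
    {in K, forall x, f x \in K} -> f r = r.
Proof.
move=> col_e; have [n le_K_n] := ubnP #|K|.
elim: n K x0 le_K_n => // n IHn K x0 le_K_n Kx0 connK.
have ltK'K := inner_proper K x0 Kx0.
have [K'0 | [y K'y]] := set_0Vmem (inner K); last first.
  have le_K'n: #|inner K| < n by have := proper_card ltK'K; lia.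
  have [r K'r rfix] := IHn _ y le_K'n K'y (inner_connected K connK).
  exists r => [|f inj_f ef colf Kf]; first by case/setIdP: K'r.
  apply: rfix => // x /setIdP[Kx nbr2]; rewrite inE Kf //.
  rewrite (leq_trans nbr2) // -(card_imset _ inj_f) subset_leq_card //.
  by apply/subsetP=> _ /imsetP[z /setIdP[Kz xz] ->]; rewrite inE Kf ?ef.
exists x0 => // f inj_f ef colf Kf; apply/eqP/negPn/negP=> neq_f.
have [p [xp Up eq_f sKp]] := connK x0 (f x0) Kx0 (Kf _ Kx0).
case: p xp Up eq_f sKp => [|a p] xp Up eq_f sKp.
  by case/eqP: neq_f.
have eq_a: a = f x0.
  apply/eqP/negPn/negP=> neq_a.
  have: a \in inner K.
    by apply: (inner_of_path K x0 (a :: p)); rewrite ?mem_head ?eq_f.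
  by rewrite K'0 inE.
by move: xp => /= /andP[/col_e + _]; rewrite eq_a colf.
Qed.

(** Any two vertices of the component are joined by a walk through r of length
    at most 2d, which contains the unique path between them. *)
Lemma forest_path_bound d r x p :
    (forall q, path e r q -> uniq (r :: q) -> size q <= d) ->
    connect e r x -> path e x p -> uniq (x :: p) ->
  size p <= d.*2.
Proof.
move=> depth rx xp Up.
have ry: connect e r (last x p).
  by apply: connect_trans rx _; apply/connectP; exists p.
have uniq_conn y: connect e r y ->
    exists q, [/\ path e r q, size q <= d & last r q = y].
  case/connectP=> q rq ->; case/shortenP: rq => q' rq' Uq' _.
  by exists q'; split=> //; apply: depth.
have [qx [rqx le_qx eq_x]] := uniq_conn x rx.
have [qy [rqy le_qy eq_y]] := uniq_conn _ ry.
have xr: path e x (rev (belast r qx)).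
  by rewrite -{1}eq_x rev_path (eq_path (e' := e)).
have last_r: last x (rev (belast r qx)) = r.
  case: (qx) eq_x => [|a q] /= => [<- // | _].
  by rewrite rev_cons last_rcons.
set w := rev (belast r qx) ++ qy.
have: path e x w by rewrite cat_path xr last_r.
have: last x w = last x p by rewrite last_cat last_r.
move/[swap]=> /shortenP[q xq Uq sub_q] eq_last.
have <-: q = p by apply: (forest_path_unique x).
have : size q <= size w.
  by apply: uniq_leq_size sub_q; case/andP: Uq.
by rewrite size_cat size_rev size_belast -addnn => /leq_trans; apply; apply: leq_add.
Qed.

End Forest.

(** * Groups of prime order normalising one another *)

Section Primes.

Variable gT : finGroupType.
Implicit Types A B C W : {group gT}.
Local Open Scope group_scope.

(** The group Aut(C) is abelian, so [A, B] centralises C; this commutator is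
    a nontrivial subgroup of A, hence it is A. *)
Lemma prime_normalizer_commutator A B C :
    prime #|C| -> prime #|A| -> A \subset 'N(C) -> B \subset 'N(C) ->
  B \subset 'N(A) -> ~~ (A \subset 'C(B)) -> A \subset 'C(C).
Proof.
move=> prC prA nCA nCB nAB ncAB.
suff: [~: A, B] \subset 'C(C).
  apply: subset_trans; apply: prime_meetG => //.
  have /setIidPr->: [~: A, B] \subset A by rewrite commg_subl.
  by apply: contra ncAB => /eqP/commG1P.
rewrite -(ker_conj_aut C) gen_subG; apply/subsetP=> _ /imset2P[a b Aa Bb ->].
have [Na Nb] := (subsetP nCA a Aa, subsetP nCB b Bb).
apply/kerP; first by rewrite groupR.
rewrite morphR //; apply/eqP/commgP.
have := Aut_cyclic_abelian (prime_cyclic prC).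
by move/centsP; apply; apply: Aut_aut.
Qed.

(** The group AB is not cyclic, so it does not embed in the cyclic group
    Aut(C). *)
Lemma prime_pair_centralizer A B C (q : nat) :
    prime #|C| -> #|A| = q -> #|B| = q -> prime q -> A != B ->
    A \subset 'N(C) -> B \subset 'N(C) -> A \subset 'C(B) ->
  exists W, [/\ W \subset A <*> B, #|W| = q & W \subset 'C(C)].
Proof.
move=> prC oA oB prq neqAB nCA nCB cAB.
have nCV: A <*> B \subset 'N(C) by rewrite join_subG nCA.
have [tiVC|ntVC] := eqVneq ('C_(A <*> B)(C)) 1.
  case/negP: neqAB.
  have cycV: cyclic (A <*> B).
    have injV: 'injm (restrm nCV (conj_aut C)).
      by rewrite ker_restrm ker_conj_aut tiVC.
    rewrite -(injm_cyclic injV) //.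
    apply: cyclicS (Aut_prime_cyclic prC).
    by apply/subsetP=> _ /morphimP[x _ _ ->]; apply: Aut_aut.
  by rewrite -val_eqE /= (eq_subG_cyclic cycV) ?joing_subl ?joing_subr // oA oB.
have pV: q.-group 'C_(A <*> B)(C).
  apply: pgroupS (subsetIl _ _) _.
  by rewrite /= cent_joinEl // pgroupM /pgroup oA oB pnat_id.
have [_ q_dv _] := pgroup_pdiv pV ntVC.
have [w /setIP[Vw Cw] ow] := Cauchy prq q_dv.
by exists <[w]>%G; rewrite -orderE ow !cycle_subG.
Qed.

(** The order of Aut(A) is #|A| - 1, which is coprime to #|B|. *)
Lemma prime_normal_cent A B :
  prime #|A| -> #|A| = #|B| -> B \subset 'N(A) -> A \subset 'C(B).
Proof.
move=> prA oB nAB; rewrite centsC; apply/negPn/negP=> ncBA.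
have prB: prime #|B| by rewrite -oB.
have tiAB: 'C_B(A) = 1 by apply: prime_TIg.
have: #|B| %| #|Aut A|.
  have injV: 'injm (restrm nAB (conj_aut A)).
    by rewrite ker_restrm ker_conj_aut tiAB.
  rewrite -(card_injm injV) //; apply: cardSg.
  by apply/subsetP=> _ /morphimP[x _ _ ->]; apply: Aut_aut.
rewrite -oB (card_Aut_cyclic (prime_cyclic prA)) totient_prime //.
by move/dvdn_leq; have := prime_gt1 prA; lia.
Qed.

End Primes.

(** * The commuting graph of the subgroups of prime order *)

Section PrimeGraph.

Variables (gT : finGroupType) (G : {group gT}).
Implicit Types A B C W : {group gT}.
Local Open Scope group_scope.

Definition prime_edge A B :=
  [&& (A \subset G) && (B \subset G), prime #|A| && prime #|B|,
      #|A| != #|B| & A \subset 'C(B)].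

Lemma prime_edgeP A B :
  reflect [/\ A \subset G /\ B \subset G, prime #|A| /\ prime #|B|,
              #|A| <> #|B| & A \subset 'C(B)] (prime_edge A B).
Proof.
apply: (iffP and4P) => [[/andP[? ?] /andP[? ?] /eqP ? ?] | [[? ?] [? ?] ? ?]].
  by split.
by split=> //; apply/andP || apply/eqP.
Qed.

Lemma prime_edge_irr : irreflexive prime_edge.
Proof. by move=> A; apply/prime_edgeP=> -[_ _ []]. Qed.

Lemma prime_edge_sym : symmetric prime_edge.
Proof.
by move=> A B; apply/prime_edgeP/prime_edgeP=> -[[? ?] [? ?] ? ?];
   split=> //; [apply/nesym | rewrite centsC | apply/nesym | rewrite centsC].
Qed.

Lemma prime_edgeJ g : g \in G ->
  {mono (fun A => (A :^ g)%G) : A B / prime_edge A B}.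
Proof.
move=> Gg A B; have subJ (X : {group gT}): (X :^ g \subset G) = (X \subset G).
  by rewrite -{1}(conjGid Gg) conjSg.
by rewrite /prime_edge /= !subJ !cardJg centJ conjSg.
Qed.

Hypothesis acyclic :
  forall s, path.cycle prime_edge s -> uniq s -> size s <= 2.

Let no_chord := forest_chord _ prime_edge prime_edge_sym acyclic.
Let path_unique := forest_path_unique _ prime_edge prime_edge_sym acyclic.

Lemma prime_edge_norm A B : prime_edge A B -> B \subset 'N(A).
Proof. by case/prime_edgeP=> _ _ _ cAB; rewrite cents_norm // centsC. Qed.

(** The path from R to its last vertex is unique, so it is mapped to itself by
    a conjugation that fixes its ends. *)
Lemma prime_path_fixed R p g :
    path prime_edge R p -> uniq (R :: p) -> g \in G -> R :^ g = R ->
    last R p :^ g = last R p ->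
  {in p, forall A, A :^ g = A}.
Proof.
move=> Rp Up Gg fixR fix_last.
pose f A := (A :^ g)%G.
have fR: f R = R by apply: val_inj.
have inj_f: injective f.
  by move=> A B /(congr1 val) /= /conjsg_inj/val_inj.
have eq_fp: map f p = p.
  apply: (path_unique R) => //.
  - rewrite -{1}fR path_map (eq_path (e' := prime_edge)) // => A B.
    exact: prime_edgeJ.
  - by rewrite -{1}fR -map_cons map_inj_uniq.
  - by rewrite -{1}fR last_map; apply: val_inj.
move=> A pA; have /(congr1 val) : nth R (map f p) (index A p) = A.
  by rewrite eq_fp nth_index.
by rewrite (nth_map R) ?index_mem // nth_index.
Qed.

(** Such an R serves as the root of its component: it is fixed by all the
    elements of G whose conjugation preserves the component. *)
Definition prime_root R :=
  forall g A, g \in G -> connect prime_edge R A -> A :^ g = A -> R :^ g = R.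

(** The group B centralises A, so its elements fix A, hence also R and all the
    vertices in between. *)
Lemma prime_path_norm R p A B :
    prime_root R -> path prime_edge R (rcons p A) -> uniq (R :: rcons p A) ->
    prime_edge A B ->
  {in R :: rcons p A, forall C, B \subset 'N(C)}.
Proof.
move=> rootR RA UA AB C pC; apply/subsetP=> g Bg.
have [[_ /subsetP sBG] _ _ cAB] := prime_edgeP _ _ AB.
have Gg := sBG g Bg.
have fixA: A :^ g = A.
  by apply: normP; apply: subsetP Bg; apply: prime_edge_norm.
have fixR: R :^ g = R.
  apply: rootR fixA => //; apply/connectP.
  by exists (rcons p A) => //; rewrite last_rcons.
apply/normP.
case/predU1P: pC => [-> // | pC].
by apply: (prime_path_fixed R (rcons p A)); rewrite ?last_rcons.
Qed.

(** If the order of B differs from those of A and C, then B does not commute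
    with C, so B = [B, C] commutes with A by [prime_normalizer_commutator];
    thus A and B are adjacent. *)
Lemma prime_path_orders A B C :
    A \subset G -> B \subset G -> C \subset G ->
    prime #|A| -> prime #|B| -> prime #|C| ->
    B \subset 'N(A) -> C \subset 'N(A) -> C \subset 'N(B) ->
    ~~ prime_edge A B -> ~~ prime_edge B C ->
  #|B| = #|A| \/ #|B| = #|C|.
Proof.
move=> sAG sBG sCG prA prB prC nAB nAC nBC nab nbc.
have [?|neqBC] := eqVneq #|B| #|C|; [by right | left].
apply/eqP/negPn/negP=> neqBA; case/negP: nab; rewrite prime_edge_sym.
apply/prime_edgeP; split=> //; first exact/eqP.
apply: prime_normalizer_commutator nAB nAC nBC _ => //.
apply: contra nbc => cBC; apply/prime_edgeP; split=> //; exact/eqP.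
Qed.

(** Assume that there is a path R, A, B, C, D, E. By [prime_path_orders], #|B|
    is #|R| or #|D|, and also #|R| or #|E|, where D and E have different orders:
    so #|B| = #|R|. Likewise #|C| is #|R| or #|E|, and it differs from #|B|: so
    #|C| = #|E|. Then C and E commute, as E normalises C, and some W of the same
    order in CE centralises R. It also centralises D, as both C and E do, so
    that R, W, D is a second path from R to D. *)
Lemma prime_depth R p :
  prime_root R -> path prime_edge R p -> uniq (R :: p) -> size p <= 4.
Proof.
move=> rootR; case: p => [|A [|B [|C [|D [|E p]]]]] // Rp Up.
have {}Rp: path prime_edge R [:: A; B; C; D; E].
  by move: Rp => /= /and5P[-> -> -> -> /andP[->]].
have {}Up: uniq [:: R; A; B; C; D; E].
  by move: Up; rewrite -[E :: p]cat1s -!cat_cons cat_uniq => /andP[].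
have nE i n : let s := take n (drop i [:: R; A; B; C; D; E]) in
    2 < size s -> ~~ prime_edge (head R s) (last R s).
  move=> s; have Us: uniq s by rewrite take_uniq // drop_uniq.
  have: sorted prime_edge s by rewrite take_sorted // drop_sorted.
  case: s Us => // X q Uq Xq; rewrite ltnS ltnNge; apply: contra.
  exact: no_chord.
have nRB := nE 0 3 isT; have nRC := nE 0 4 isT; have nRE := nE 0 6 isT.
have nBD := nE 2 3 isT; have nBE := nE 2 4 isT; have nCE := nE 3 3 isT.
simpl in nRB, nRC, nRE, nBD, nBE, nCE.
have [RA AB BC CD /andP[DE _]] := and5P Rp.
have Upre n : uniq (take n [:: R; A; B; C; D; E]) by rewrite take_uniq.
have nRA_B: {in [:: R; A], forall X : {group gT}, B \subset 'N(X)}.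
  by apply: (prime_path_norm R [::]) => //=; [rewrite RA | apply: (Upre 2)].
have nRB_C: {in [:: R; A; B], forall X : {group gT}, C \subset 'N(X)}.
  by apply: (prime_path_norm R [:: A]) => //=; [rewrite RA AB | apply: (Upre 3)].
have nRC_D: {in [:: R; A; B; C], forall X : {group gT}, D \subset 'N(X)}.
  apply: (prime_path_norm R [:: A; B]) => //=; first by rewrite RA AB BC.
  exact: (Upre 4).
have nRD_E: {in [:: R; A; B; C; D], forall X : {group gT}, E \subset 'N(X)}.
  apply: (prime_path_norm R [:: A; B; C]) => //=; first by rewrite RA AB BC CD.
  exact: (Upre 5).
have [[sRG _] [prR _] _ _] := prime_edgeP _ _ RA.
have [[sBG sCG] [prB prC] neqBC _] := prime_edgeP _ _ BC.
have [[_ sDG] [_ prD] neqCD cCD] := prime_edgeP _ _ CD.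
have [[_ sEG] [_ prE] neqDE cDE] := prime_edgeP _ _ DE.
have ordB : #|B| = #|R|.
  have [//|eqBD] : #|B| = #|R| \/ #|B| = #|D|.
    by apply: prime_path_orders; rewrite ?nRA_B ?nRC_D // !inE eqxx ?orbT.
  have [//|eqBE] : #|B| = #|R| \/ #|B| = #|E|.
    by apply: prime_path_orders; rewrite ?nRA_B ?nRD_E // !inE eqxx ?orbT.
  by case: neqDE; rewrite -eqBD.
have ordC : #|C| = #|E|.
  have [eqCR|//] : #|C| = #|R| \/ #|C| = #|E|.
    by apply: prime_path_orders; rewrite ?nRB_C ?nRD_E // !inE eqxx ?orbT.
  by case: neqBC; rewrite ordB.
have neqCE: C != E.
  by move: (Upre 6) => /= /and5P[_ _ _ + _]; rewrite !inE => /norP[].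
have cCE: C \subset 'C(E).
  by apply: prime_normal_cent; rewrite ?nRD_E // !inE eqxx ?orbT.
have [W [sW oW cW]]: exists W : {group gT},
    [/\ W \subset C <*> E, #|W| = #|C| & W \subset 'C(R)].
  apply: prime_pair_centralizer => //.
    by rewrite nRB_C // mem_head.
  by rewrite nRD_E // mem_head.
have sWG: W \subset G by rewrite (subset_trans sW) // join_subG sCG.
have prW: prime #|W| by rewrite oW.
have RW: prime_edge R W.
  apply/prime_edgeP; split=> //; last by rewrite centsC.
  by rewrite oW -ordB.
have WD: prime_edge W D.
  apply/prime_edgeP; split=> //; first by rewrite oW.
  by rewrite (subset_trans sW) // join_subG cCD centsC.
suff: [:: A; B; C; D] = [:: W; D] by [].
apply: (path_unique R) => //=.
- by rewrite RA AB BC CD.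
- by rewrite RW WD.
- exact: (Upre 5).
have neq_edge X Y : prime_edge X Y -> X != Y.
  by apply: contraTneq => ->; rewrite prime_edge_irr.
rewrite /= !inE (negPf (neq_edge _ _ RW)) neq_edge //.
by move: (Upre 5) => /= /andP[]; rewrite !inE !negb_or => /and4P[_ _ _ ->].
Qed.

Lemma prime_path_bound A p :
  path prime_edge A p -> uniq (A :: p) -> size p <= 8.
Proof.
have csym := sym_connect_sym prime_edge_sym.
pose K := [set B | connect prime_edge A B].
have KA: A \in K by rewrite inE connect0.
have connK: path_connected _ prime_edge K.
  move=> X Y /[!inE] AX AY.
  have: connect prime_edge X Y by apply: connect_trans AY; rewrite csym.
  case/connectP=> p0 Xp0 ->; case/shortenP: Xp0 => q Xq Uq _.
  exists q; split=> // Z qZ; rewrite inE; apply: connect_trans AX _.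
  case/splitPr: qZ Xq {Uq} => q1 q2; rewrite -cat_rcons cat_path => /andP[Xq _].
  by apply/connectP; exists (rcons q1 Z) => //; rewrite last_rcons.
have col_edge X Y : prime_edge X Y -> #|X| <> #|Y| by case/prime_edgeP.
have [R KR fixR] := forest_fixed_vertex _ prime_edge prime_edge_irr
  prime_edge_sym acyclic (fun X : {group gT} => #|X|) K A col_edge KA connK.
have rootR: prime_root R.
  move=> g B Gg RB fixB; pose f X := (X :^ g)%G.
  have fB: f B = B by apply: val_inj.
  suff: f R = R by move/(congr1 val).
  apply: fixR => [X Y /(congr1 val) /= /conjsg_inj/val_inj // | | X | X].
  - exact: prime_edgeJ.
  - by rewrite /= cardJg.
  rewrite !inE => AX; have AB: connect prime_edge A B.
    by apply: connect_trans RB; rewrite inE in KR.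
  apply: connect_trans AB _; rewrite -fB.
  have: connect prime_edge B X.
    apply: connect_trans AX; rewrite csym; apply: connect_trans RB.
    by rewrite inE in KR.
  case/connectP=> q Bq ->; apply/connectP; exists (map f q); last by rewrite last_map.
  by rewrite path_map (eq_path (e' := prime_edge)) // => Y Z; apply: prime_edgeJ.
apply: (forest_path_bound _ _ prime_edge_sym acyclic 4 R) => [q|].
  exact: prime_depth.
by rewrite csym; rewrite inE in KR.
Qed.

End PrimeGraph.

(** * From power graphs to commuting graphs *)

Section PowerGraphPaths.

Variables (gT : finGroupType) (G : {group gT}).
Implicit Types x y h : gT.
Local Open Scope group_scope.

Lemma Pow_adjE x y :
  adj (Pow G) x y <->
    [/\ x \in G, y \in G, x != y & (x \in <[y]>) || (y \in <[x]>)].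
Proof.
split=> [[Gx Gy neq_xy [m xy]] | [Gx Gy neq_xy xy]]; split=> //.
- exact/eqP.
- by case: xy => <-; rewrite mem_cycle ?orbT.
- exact/eqP.
- by case/orP: xy => /cycleP[m ->]; exists m; [right | left].
Qed.

(** Otherwise h, a, h', b would be an induced 4-cycle: the intersection of two
    incomparable cyclic groups has prime power order. *)
Lemma chordal_cap h h' a b :
    chordal (Pow G) -> h \in G -> h' \in G ->
    h \notin <[h']> -> h' \notin <[h]> ->
    a \in <[h]> -> a \in <[h']> -> b \in <[h]> -> b \in <[h']> ->
  (a \in <[b]>) || (b \in <[a]>).
Proof.
move=> chG Gh Gh' hh' h'h ah ah' bh bh'.
apply/negPn/negP; rewrite negb_or => /andP[ab ba].
have memT x y z : x \in <[y]> -> y \in <[z]> -> x \in <[z]>.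
  by move=> xy yz; apply: subsetP xy; rewrite cycle_subG.
have sub_G x y : x \in G -> y \in <[x]> -> y \in G.
  by move=> Gx; apply: subsetP; rewrite cycle_subG.
have ha: h \notin <[a]> by apply: contra hh' => /memT->.
have hb: h \notin <[b]> by apply: contra hh' => /memT->.
have h'a: h' \notin <[a]> by apply: contra h'h => /memT->.
have h'b: h' \notin <[b]> by apply: contra h'h => /memT->.
have neq x y : x \notin <[y]> -> x != y.
  by apply: contraNneq => ->; apply: cycle_id.
pose s := [:: h; a; h'; b].
have Us: uniq s.
  rewrite /= !inE !negb_or [a == h']eq_sym.
  by rewrite (neq h a) ?(neq h h') ?(neq h b) ?(neq h' a) ?(neq a b) ?(neq h' b).
have Gs x : x \in s -> x \in G.
  by rewrite !inE => /or4P[] /eqP-> //; apply: (sub_G h).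
apply: (chG 4) => //; exists (fun i : 'I_4 => nth 1 s i); split=> //.
- move=> i j /eqP; rewrite nth_uniq //; first by move/eqP/val_inj.
- by move=> i; apply/Gs/mem_nth.
move=> i j; rewrite Pow_adjE !Gs ?mem_nth // nth_uniq //.
case: i j => [[|[|[|[|//]]]] ?] [[|[|[|[|//]]]] ?] /=;
  by split; [case=> _ _; rewrite ?cycle_id ?(negPf hh') ?(negPf h'h)
                                 ?(negPf ab) ?(negPf ba) //;
             move=> *; by [left | right]
           | case=> // _; split=> //; rewrite ?ah ?ah' ?bh ?bh' ?orbT].
Qed.

Definition cycle_gen (A : {group gT}) : gT :=
  odflt 1 [pick x | <[x]> == A :> {set gT}].

Lemma cycle_genE (A : {group gT}) : prime #|A| -> <[cycle_gen A]> = A.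
Proof.
move/prime_cyclic/cyclicP=> [x defA]; rewrite /cycle_gen.
by case: pickP => [y /eqP | /(_ x)/eqP[]].
Qed.

Lemma modS_if n k : k < n -> k.+1 %% n = if k.+1 == n then 0 else k.+1.
Proof.
move=> lt_kn; case: eqP => [->|neq_n]; first by rewrite modnn.
by rewrite modn_small //; lia.
Qed.

(** With a_k generating the k-th vertex of s and b_k = a_k a_(k+1), the
    sequence a_0, b_0, a_1, b_1, ... is a cycle of length 2n in Pow(G). It is
    induced because the only subgroups of prime order of the cyclic group
    generated by b_k are the k-th and the (k+1)-th vertices of s. *)
Lemma chordal_prime_edge_acyclic s :
  chordal (Pow G) -> path.cycle (prime_edge _ G) s -> uniq s -> size s <= 2.
Proof.
move=> chG cyc_s Us; rewrite leqNgt; apply/negP; set n := size s => lt2n.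
pose z k := nth 1%G s k; pose a k := cycle_gen (z k).
pose k' k := k.+1 %% n; pose b k := a k * a (k' k).
have lt_k' k : k' k < n by rewrite ltn_mod; lia.
have z_edge k : k < n -> prime_edge _ G (z k) (z (k' k)).
  rewrite /z /k' /n => lt_k; rewrite modS_if //.
  case: (s) cyc_s lt_k => //= A q /(pathP 1%G) /(_ k).
  rewrite size_rcons nth_rcons ltnS eqSS => eA lt_k; move: (eA lt_k).
  have [eq_k|neq_k] := eqVneq k (size q).
    by rewrite eq_k ltnn -rcons_cons nth_rcons /= ltnSn.
  have -> : k < size q by rewrite ltn_neqAle neq_k.
  by rewrite -rcons_cons nth_rcons /= ltnS lt_k.
have prz k : k < n -> prime #|z k|.
  by move/z_edge/prime_edgeP=> [_ []].
have zG k : k < n -> z k \subset G.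
  by move/z_edge/prime_edgeP=> [[]].
have defz k : k < n -> <[a k]> = z k by move/prz/cycle_genE.
have defb k : k < n -> <[b k]> = z k * z (k' k).
  move=> lt_k; have [_ _ neq_k cz] := prime_edgeP _ _ _ _ (z_edge k lt_k).
  rewrite cycleM ?defz //.
    by apply: (centsP cz); rewrite -defz ?cycle_id.
  by rewrite /order !defz // prime_coprime ?prz // dvdn_prime2 ?prz //; apply/eqP.
have ab k : k < n -> a k \in <[b k]>.
  by move=> lt_k; rewrite defb // (subsetP (mulG_subl _ _)) // -defz // cycle_id.
have ab' k : k < n -> a (k' k) \in <[b k]>.
  move=> lt_k; rewrite defb // (subsetP (mulG_subr _ _)) // -defz //.
  exact: cycle_id.
have ordb k : k < n -> #|<[b k]>| = (#|z k| * #|z (k' k)|)%N.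
  move=> lt_k; have [_ _ neq_k _] := prime_edgeP _ _ _ _ (z_edge k lt_k).
  rewrite defb // coprime_cardMg // prime_coprime ?prz // dvdn_prime2 ?prz //.
  exact/eqP.
have z_inj j k : j < n -> k < n -> z j = z k -> j = k.
  by move=> lt_j lt_k /eqP; rewrite nth_uniq // => /eqP.
have aaP j k : j < n -> k < n -> a j \in <[a k]> -> j = k.
  move=> lt_j lt_k; rewrite -cycle_subG /= !defz // => szz; apply: z_inj => //.
  apply/val_inj/eqP; rewrite /= eqEcard szz.
  by have:= cardSg szz; rewrite dvdn_prime2 ?prz // => /eqP->; rewrite leqnn.
have abP j k : j < n -> k < n -> a j \in <[b k]> -> j = k \/ j = k' k.
  move=> lt_j lt_k ajb; have szb: z j \subset <[b k]> by rewrite -defz ?cycle_subG.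
  have:= cardSg szb; rewrite ordb // Euclid_dvdM ?prz //.
  have z_eq i : i < n -> a i \in <[b k]> -> #|z j| %| #|z i| -> j = i.
    rewrite -cycle_subG /= => lt_i; rewrite defz // => sib.
    rewrite dvdn_prime2 ?prz // => oij; apply: z_inj => //; apply/val_inj/eqP.
    by rewrite (eq_subG_cyclic (cycle_cyclic (b k))).
  by case/orP=> /z_eq->; [left | | | right | |]; rewrite ?ab ?ab'.
have baP j k : j < n -> k < n -> b j \notin <[a k]>.
  move=> lt_j lt_k; apply/negP; rewrite -cycle_subG => sba.
  have [_ _ []] := prime_edgeP _ _ _ _ (z_edge j lt_j).
  have card_eq i : i < n -> a i \in <[b j]> -> #|z i| = #|z k|.
    move=> lt_i /(subsetP sba); rewrite -cycle_subG /= !defz // => /cardSg.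
    by rewrite dvdn_prime2 ?prz // => /eqP.
  by rewrite !card_eq ?ab ?ab'.
have bbP j k : j < n -> k < n -> b j \in <[b k]> -> j = k.
  move=> lt_j lt_k; rewrite -cycle_subG => /subsetP sbb.
  have := abP j k lt_j lt_k (sbb _ (ab j lt_j)).
  have := abP (k' j) k (lt_k' j) lt_k (sbb _ (ab' j lt_j)).
  (* Both j and j + 1 belong to {k, k + 1} modulo n, and n > 2. *)
  rewrite /k' !modS_if //; do 2!case: eqP; lia.
have aG k : k < n -> a k \in G.
  by move=> lt_k; rewrite -cycle_subG defz // zG.
have bG k : k < n -> b k \in G by move=> lt_k; rewrite groupM ?aG.
pose c (i : 'I_(n.*2)) := if odd i then b i./2 else a i./2.
have cP (i : 'I_(n.*2)) : exists2 k, k < n &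
    i = k.*2 :> nat /\ c i = a k \/ i = k.*2.+1 :> nat /\ c i = b k.
  exists i./2; first by have := ltn_ord i; clear; lia.
  rewrite /c; have := odd_double_half i.
  by case: (odd i) => /= eq_i; [right | left]; split=> //; clear -eq_i; lia.
have c_inj: injective c.
  move=> i j; have [[k lt_k ci] [l lt_l cj]] := (cP i, cP j).
  move=> eq_c; apply: val_inj => /=; move: eq_c (baP k l) (baP l k).
  case: ci cj => [] [-> ->] [] [-> ->] eq_c.
  - by move=> _ _; rewrite (aaP k l) // eq_c cycle_id.
  - by rewrite eq_c cycle_id => _ /(_ lt_l lt_k).
  - by rewrite eq_c cycle_id => /(_ lt_k lt_l).
  by move=> _ _; rewrite (bbP k l) // eq_c cycle_id.
have cG i : c i \in G.
  by have [k lt_k [] [_ ->]] := cP i; rewrite ?aG ?bG.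
apply: (chG n.*2); first by rewrite -addnn; lia.
exists c; split=> //; first by rewrite -addnn; lia.
move=> i j; rewrite Pow_adjE !cG inj_eq // !modS_if //.
have [[k lt_k ci] [l lt_l cj]] := (cP i, cP j).
have k'E : k' k = if k.+1 == n then 0 else k.+1 by apply: modS_if.
have l'E : k' l = if l.+1 == n then 0 else l.+1 by apply: modS_if.
have neq_nat : i != j -> i <> j :> nat by move=> + /val_inj=> /eqP.
case: ci cj => [] [ei ->] [] [ej ->]; split.
- case=> _ _ /neq_nat neq_ij /orP[] /aaP eq_kl; lia.
- by rewrite ei ej; do 2!case: eqP; lia.
- case=> _ _ _ /orP[/abP[]// e|]; last by rewrite (negPf (baP _ _ _ _)).
    by rewrite ei ej e; do 2!case: eqP; lia.
  by rewrite ei ej e l'E; do 3!case: eqP; lia.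
- move=> adj_ij; split=> //; first by apply/eqP=> /(congr1 val) /=; lia.
  have [->|->] : k = l \/ k = k' l.
  + by move: adj_ij; rewrite l'E ei ej; do 3!case: eqP; lia.
  + by rewrite ab.
  + by rewrite ab'.
- case=> _ _ _ /orP[|/abP[]// e]; first by rewrite (negPf (baP _ _ _ _)).
    by rewrite ei ej e; do 2!case: eqP; lia.
  by rewrite ei ej e k'E; do 3!case: eqP; lia.
- move=> adj_ij; split=> //; first by apply/eqP=> /(congr1 val) /=; lia.
  have [->|->] : l = k \/ l = k' k.
  + by move: adj_ij; rewrite k'E ei ej; do 3!case: eqP; lia.
  + by rewrite ab ?orbT.
  + by rewrite ab' ?orbT.
- case=> _ _ /neq_nat neq_ij /orP[] /bbP eq_kl; lia.
- by rewrite ei ej; do 2!case: eqP; lia.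
Qed.

(** * Induced paths in chordal power graphs *)

Lemma order_dvd_mem_cycle x y h :
  x \in <[h]> -> y \in <[h]> -> #[x] %| #[y] -> x \in <[y]>.
Proof.
move=> hx hy; rewrite !orderE (cardSg_cyclic (cycle_cyclic h)) ?cycle_subG //.
Qed.

(** Two p-elements of a cyclic group are always comparable. *)
Lemma other_prime x y h (p : nat) :
    x \in <[h]> -> y \in <[h]> -> x \notin <[y]> -> y \notin <[x]> ->
    p.-elt y ->
  exists q, [/\ prime q, q %| #[x] & q <> p].
Proof.
move=> hx hy xy yx p_y.
have [/hasP[q]|/hasPn p_x] := boolP (has (predC1 p) (primes #[x])).
  by rewrite mem_primes => /and3P[prq _ qx] /eqP neq_qp; exists q.
have{} p_x: p.-elt x.
  apply/pnatP=> [|q prq qx]; first exact: order_gt0.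
  have /p_x : q \in primes #[x] by rewrite mem_primes prq order_gt0.
  by rewrite /= negbK.
have [[m ox] [k oy]] := (p_natP p_x, p_natP p_y).
have [le_mk | le_km] := leqP m k.
  by case/negP: xy; apply: (order_dvd_mem_cycle _ _ h); rewrite // ox oy dvdn_exp2l.
case/negP: yx; apply: (order_dvd_mem_cycle _ _ h); rewrite // ox oy dvdn_exp2l //.
exact: ltnW.
Qed.

Definition prime_part x p : gT := x ^+ (#[x] %/ p).

Lemma order_prime_part x (p : nat) : prime p -> p %| #[x] -> #[prime_part x p] = p.
Proof.
by move=> prp px; rewrite orderXdiv ?dvdn_div // divnA // mulKn.
Qed.

(** For 0 < i < 9, the element y_i lies in both h_(i-1) and h_i, so it is a
    p_i-element for a prime p_i; for the two ends, p_i is a prime divisor of the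
    order of y_i other than the prime of the neighbouring y. Let z_i be the
    subgroup of order p_i generated by a power of y_i. Consecutive z_i are
    adjacent, and z_i = z_(i+2) would put the incomparable elements y_(i+1) and
    a generator of z_i in both h_i and h_(i+1). So the ten z_i form a path. *)
Lemma chordal_no_zigzag (y h : nat -> gT) :
    chordal (Pow G) ->
    (forall i, i < 9 -> [/\ h i \in G, y i \in <[h i]> & y i.+1 \in <[h i]>]) ->
    (forall i, i < 9 -> y i \notin <[y i.+1]> /\ y i.+1 \notin <[y i]>) ->
    (forall i, i < 8 -> h i \notin <[h i.+1]> /\ h i.+1 \notin <[h i]>) ->
  False.
Proof.
move=> chG hG neq_y neq_h.
have cap i a b : i < 8 -> a \in <[h i]> -> a \in <[h i.+1]> ->
    b \in <[h i]> -> b \in <[h i.+1]> -> (a \in <[b]>) || (b \in <[a]>).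
  move=> lt_i; have [[Gi _ _] [Gi' _ _]] := (hG i (ltnW lt_i), hG i.+1 lt_i).
  by have [? ?] := neq_h i lt_i; apply: chordal_cap Gi Gi' _ _.
have part_in x g p : x \in <[g]> -> prime_part x p \in <[g]> by apply: groupX.
pose pp i := pdiv #[y i].
have pp_elt i : i < 8 -> (pp i.+1).-elt (y i.+1).
  move=> lt_i; have [_ _ yh] := hG i (ltnW lt_i).
  have [_ yh' _] := hG i.+1 lt_i; have [_ y'y] := neq_y i (ltnW lt_i).
  have ntY: 1 < #[y i.+1] by rewrite order_gt1; apply: contraNneq y'y => ->.
  apply/pnatP=> [|q prq qy]; first exact: order_gt0.
  have [prp py] := (pdiv_prime ntY, pdiv_dvd #[y i.+1]).
  have := cap i (prime_part (y i.+1) q) (prime_part (y i.+1) (pp i.+1)) lt_i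
    (part_in _ _ _ yh) (part_in _ _ _ yh') (part_in _ _ _ yh) (part_in _ _ _ yh').
  rewrite -!cycle_subG => /orP[] /cardSg; rewrite -!orderE !order_prime_part //.
    by rewrite dvdn_prime2.
  by rewrite dvdn_prime2 // eq_sym.
have next_prime i : i < 8 -> exists q, [/\ prime q, q %| #[y i] & q <> pp i.+1].
  move=> lt_i; have [_ yh yh'] := hG i (ltnW lt_i).
  have [yy' y'y] := neq_y i (ltnW lt_i).
  exact: other_prime yh yh' yy' y'y (pp_elt i lt_i).
have [q0 [prq0 q0y neq_q0]] := next_prime 0 isT.
have [q9 [prq9 q9y neq_q9]] : exists q, [/\ prime q, q %| #[y 9] & q <> pp 8].
  have [_ yh yh'] := hG 8 isT; have [yy' y'y] := neq_y 8 isT.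
  exact: other_prime yh' yh y'y yy' (pp_elt 7 isT).
pose p i := if i == 0 then q0 else if i == 9 then q9 else pp i.
have pP i : i < 10 -> prime (p i) /\ p i %| #[y i].
  rewrite /p; case: i => [|i] //= lt_i; case: eqP => [[->] //|neq_i].
  have lt_i8: i < 8 by lia.
  have [_ y'y] := neq_y i (ltnW lt_i8).
  split; last exact: pdiv_dvd.
  by rewrite pdiv_prime // order_gt1; apply: contraNneq y'y => ->.
have p_neq i : i < 9 -> p i <> p i.+1.
  rewrite /p; case: i => [|i] //= lt_i; rewrite !eqSS.
  have lt_i8: i < 8 by lia.
  have -> : i == 8 = false by lia.
  have [-> /esym //|neq_i] := eqVneq i 7.
  have lt_i7: i.+1 < 8 by lia.
  have [q [prq qy neq_q]] := next_prime i.+1 lt_i7.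
  have /pnatP := pp_elt i lt_i8; rewrite order_gt0 => /(_ isT q prq qy).
  by rewrite inE => /eqP <-.
pose z i := <[prime_part (y i) (p i)]>%G.
have oz i : i < 10 -> #|z i| = p i.
  by move=> /pP[prp py]; rewrite /z /= -orderE order_prime_part.
have z_edge i : i < 9 -> prime_edge _ G (z i) (z i.+1).
  move=> lt_i; have [Gh yh yh'] := hG i lt_i.
  have [[prp _] [prp' _]] := (pP i (ltnW lt_i), pP i.+1 lt_i).
  have sub_h x : x \in <[h i]> -> x \in G by apply: subsetP; rewrite cycle_subG.
  apply/prime_edgeP; rewrite !oz ?(leqW lt_i) //; split=> //.
  - by rewrite !cycle_subG !sub_h // part_in.
  - exact: p_neq.
  apply: (sub_abelian_cent2 (cycle_abelian (h i))); rewrite cycle_subG part_in //.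
have z_nbt i : i < 8 -> z i != z i.+2.
  move=> lt_i; apply/eqP=> eq_z; have [_ yh y'h] := hG i (ltnW lt_i).
  have [_ y'h' y''h'] := hG i.+1 lt_i.
  have [/ltnW lt_i9 lt_i9'] : i.+1 < 10 /\ i.+1 < 10 by lia.
  have [[prp py] [prp' py']] := (pP i lt_i9, pP i.+1 lt_i9').
  have neq_p: p i <> p i.+1 by apply: p_neq; apply: ltnW.
  have zh': prime_part (y i) (p i) \in <[h i.+1]>.
    have -> : (prime_part (y i) (p i) \in <[h i.+1]>) = (z i \subset <[h i.+1]>).
      by rewrite cycle_subG.
    by rewrite eq_z cycle_subG part_in.
  have := cap i _ _ lt_i (part_in _ _ (p i) yh) zh'
    (part_in _ _ (p i.+1) y'h) (part_in _ _ (p i.+1) y'h').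
  rewrite -!cycle_subG => /orP[] /cardSg; rewrite -!orderE !order_prime_part //.
    by rewrite dvdn_prime2 // => /eqP.
  by rewrite dvdn_prime2 // => /eqP/esym.
have acyc s := chordal_prime_edge_acyclic s chG.
have z_path: path (prime_edge _ G) (z 0) (mkseq (fun i => z i.+1) 9).
  apply/(pathP 1%G) => i; rewrite size_mkseq => lt_i.
  rewrite nth_mkseq //; have -> : nth 1%G (z 0 :: mkseq (fun i => z i.+1) 9) i = z i.
    by case: i lt_i => // i lt_i; rewrite /= nth_mkseq // ltnW.
  exact: z_edge.
suff Uz: uniq (z 0 :: mkseq (fun i => z i.+1) 9).
  by have := prime_path_bound _ G acyc _ _ z_path Uz; rewrite size_mkseq.
apply: (forest_walk_uniq _ _ (prime_edge_irr _ G) acyc 1%G) => // i lt_i.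
have lt_i8: i < 8 by move: lt_i; rewrite /=; lia.
have nth_z j : j < 10 -> nth 1%G (z 0 :: mkseq (fun i => z i.+1) 9) j = z j.
  by case: j => // j lt_j; rewrite /= nth_mkseq.
have [lt_i10 lt_i10'] : i < 10 /\ i.+2 < 10 by lia.
by rewrite !nth_z ?z_nbt.
Qed.

(** Induced paths on 20 vertices, as sequences indexed by nat; this makes
    shifting and reversing indices easier. *)
Definition zigzag (q : nat -> gT) := forall i j, i < 20 -> j < 20 ->
  q i \in G /\
  (q i \in <[q j]>) || (q j \in <[q i]>) = [|| i == j, j == i.+1 | i == j.+1].

(** Inclusion of cyclic groups is transitive, so two consecutive inclusions in
    the same direction would join q_i and q_(i+2). *)
Lemma zigzag_up q i : zigzag q -> i.+2 < 20 ->
  q i \in <[q i.+1]> -> q i.+2 \in <[q i.+1]>.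
Proof.
move=> zq lt_i qi; have [lt1 lt0] : i.+1 < 20 /\ i < 20 by lia.
have [_] := zq i.+1 i.+2 lt1 lt_i; rewrite eqxx orbT => /orP[] // qi'.
have [_] := zq i i.+2 lt0 lt_i; rewrite (subsetP _ _ qi) ?cycle_subG //=.
by move/esym; clear; lia.
Qed.

Lemma zigzag_down q i : zigzag q -> i.+2 < 20 ->
  q i.+1 \in <[q i]> -> q i.+1 \in <[q i.+2]>.
Proof.
move=> zq lt_i qi; have [lt1 lt0] : i.+1 < 20 /\ i < 20 by lia.
have [_] := zq i.+1 i.+2 lt1 lt_i; rewrite eqxx orbT => /orP[] // qi'.
have [_] := zq i i.+2 lt0 lt_i.
rewrite (subsetP _ _ qi') ?cycle_subG // orbT.
by move/esym; clear; lia.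
Qed.

(** If q_0 were below q_1, then all the q_(2i) would be below their
    neighbours, against [chordal_no_zigzag]. *)
Lemma chordal_zigzag q : chordal (Pow G) -> zigzag q -> q 0 \notin <[q 1%N]>.
Proof.
move=> chG zq; apply/negP=> q01.
have low i : i < 10 -> q i.*2 \in <[q i.*2.+1]>.
  elim: i => [|i IHi] // lt_i; rewrite doubleS.
  apply: zigzag_down => //; first by clear -lt_i; lia.
  apply: zigzag_up => //; first by clear -lt_i; lia.
  by apply: IHi; apply: ltnW.
have incomp i : i.+2 < 20 -> q i \notin <[q i.+2]> /\ q i.+2 \notin <[q i]>.
  move=> lt_i; have lt0: i < 20 by lia.
  have [_] := zq i i.+2 lt0 lt_i; rewrite (_ : [|| _, _ | _] = false); last by lia.
  by move/negbT; rewrite negb_or => /andP.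
apply: (chordal_no_zigzag (fun i => q i.*2) (fun i => q i.*2.+1)) => //= i lt_i.
- split; first by apply: (proj1 (zq i.*2.+1 0 _ _)) => //; clear -lt_i; lia.
    by apply: low; apply: ltnW.
  rewrite doubleS; apply: zigzag_up => //; first by clear -lt_i; lia.
  by apply: low; apply: ltnW.
- by rewrite doubleS; apply: incomp; clear -lt_i; lia.
by rewrite doubleS; apply: incomp; clear -lt_i; lia.
Qed.

(** By alternation and parity, one of the two ends lies below its neighbour;
    [chordal_zigzag] then applies to the path or to its reversal. *)
Lemma chordal_no_induced_path20 : chordal (Pow G) -> ~ has_induced_path (Pow G) 20.
Proof.
move=> chG [p [inj_p Gp adj_p]]; pose q i := p (inord i : 'I_20).
have zq: zigzag q.
  move=> i j lt_i lt_j; split; first exact: Gp.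
  have [->|neq_ij] := eqVneq i j; first by rewrite cycle_id.
  have neq_q: q i != q j.
    rewrite (inj_eq inj_p); apply: contraNneq neq_ij => /(congr1 val).
    by rewrite /= !inordK // => ->.
  rewrite /=; apply/idP/orP=> [qij | ij].
    have : adj (Pow G) (q i) (q j) by apply/Pow_adjE; split; rewrite ?Gp.
    by move/adj_p; rewrite !inordK // => -[]; [left | right]; apply/eqP.
  have: adj (Pow G) (q i) (q j).
    by apply/adj_p; rewrite !inordK //; case: ij => /eqP; [left | right].
  by case/Pow_adjE.
have zq': zigzag (fun i => q (19 - i)).
  move=> i j lt_i lt_j; have [lt_i' lt_j']: 19 - i < 20 /\ 19 - j < 20.
    by clear; lia.
  have [Gi eq_ij] := zq _ _ lt_i' lt_j'; split=> //.
  by rewrite eq_ij; clear -lt_i lt_j; lia.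
have q01 := chordal_zigzag q chG zq.
have q19 := chordal_zigzag _ chG zq'.
have q10: q 1%N \in <[q 0]>.
  by have [//|//|_] := zq 0 1%N; rewrite (negPf q01).
have down i : i < 10 -> q i.*2.+1 \in <[q i.*2]>.
  elim: i => [|i IHi] // lt_i; rewrite doubleS.
  apply: zigzag_up => //; first by clear -lt_i; lia.
  apply: zigzag_down => //; first by clear -lt_i; lia.
  by apply: IHi; apply: ltnW.
by case/negP: q19; apply: (down 9).
Qed.

End PowerGraphPaths.

(** * The theorem *)

Lemma induced_path_prefix (T : finType) (Gamma : simple_graph T) k L :
  k <= L -> has_induced_path Gamma L -> has_induced_path Gamma k.
Proof.
move=> le_kL [p [inj_p Vp adj_p]]; exists (p \o widen_ord le_kL).
split=> [i j /inj_p/(congr1 val) /= eq_ij | i | i j] /=.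
- exact: val_inj.
- exact: Vp.
- exact: adj_p.
Qed.

Lemma induced_cycle_prefix (T : finType) (Gamma : simple_graph T) k l :
  k < l -> has_induced_cycle Gamma l -> has_induced_path Gamma k.
Proof.
move=> lt_kl [c [_ inj_c Vc adj_c]]; exists (c \o widen_ord (ltnW lt_kl)).
split=> [i j /inj_c/(congr1 val) /= eq_ij | i | i j] /=.
- exact: val_inj.
- exact: Vc.
by rewrite adj_c /= !modn_small // (leq_ltn_trans _ lt_kl).
Qed.

Theorem theorem1p2 (gT : finGroupType) (G : {group gT}) :
  (chordal (Pow G) ->
     forall (L : nat) (p : 'I_L -> gT), induced_path (Pow G) p -> L <= 19)
  /\
  (chordal (Pow G) <->
     (forall l : nat, 4 <= l <= 20 -> ~ has_induced_cycle (Pow G) l)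
     /\ ~ has_induced_path (Pow G) 20).
Proof.
split=> [chG L p pathp | ].
  rewrite leqNgt; apply/negP=> lt19L; apply: (chordal_no_induced_path20 _ G chG).
  by apply: induced_path_prefix lt19L _; exists p.
split=> [chG | [no_cycle no_path] l ge4l cycle_l].
  split=> [l /andP[ge4l _] | ]; first exact: chG.
  exact: chordal_no_induced_path20.
have [le_l20 | lt20l] := leqP l 20; first by apply: (no_cycle l); rewrite ?ge4l.
exact: no_path (induced_cycle_prefix _ _ 20 l lt20l cycle_l).
Qed.
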